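(* Let $(M,d)$ be a metric space and let $A\subset M$ be a closed subspace (i.e. a closed subset with the induced metric). Let $E$ be a normed space, and let $\varphi:M\to E$ be a map such that the restriction $\varphi_{|A}$ is continuous. Then, for all $\delta>0$, there exists a continuous map $\Phi:M\to \mathrm{conv}(\varphi(M))$ such that $\Phi_{|A}=\varphi_{|A}$ and $$\sup_{x\in M}\|\varphi(x)-\Phi(x)\|\le \inf_{s>0}\omega_\varphi(s)+\inf_{s>0}\omega_{\varphi_{|A}}(s)+\delta.$$ In particular, if $\varphi$ is coarse (resp. a coarse embedding), so is $\Phi$.
   Context: For a map $f:(M,d)\to(N,\partial)$ between metric spaces and $t\ge 0$, let $\omega_f(t)=\sup\{\partial(f(x),f(y)) : d(x,y)\le t\}\in[0,\infty]$ (equal to $0$ if the domain is empty) and $\rho_f(t)=\inf\{\partial(f(x),f(y)) : d(x,y)\ge t\}$ (with $\inf\emptyset=\infty$). $f$ is coarse if $\omega_f(t)<\infty$ for all $t\ge 0$; expanding if $\lim_{t\to\infty}\rho_f(t)=\infty$; a coarse embedding if it is both coarse and expanding. $\mathrm{conv}(S)$ denotes the convex hull (not closed) of a subset $S$ of a vector space. The case $A=\emptyset$ is allowed. *)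

(* Defs.v *)
From HB Require Import structures.
From mathcomp Require Import all_boot all_order all_algebra.
From mathcomp Require Import all_classical all_reals interval_inference.
From mathcomp Require Import ereal topology normedtype convex.

Set Implicit Arguments.
Unset Strict Implicit.
Unset Printing Implicit Defensive.

Import Order.TTheory GRing.Theory Num.Theory.
Import numFieldNormedType.Exports.

Local Open Scope classical_set_scope.
Local Open Scope ring_scope.

(* The library puts only a pseudometric on a normed space: this is the
   metric space structure given by the norm. *)
Section normed_metric.
Context {R : realType} {E : normedModType R}.

Let dist (x y : E) : R := `|y - x|.

Let dist_ge0 x y : 0 <= dist x y.
Proof. exact: normr_ge0. Qed.

Let dist_positivity x y : dist x y = 0 -> x = y.
Proof. by move/normr0_eq0/eqP; rewrite subr_eq0 => /eqP. Qed.

Let ballEdist (x : E) d : ball x d = [set y | dist x y < d].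
Proof. by rewrite -ball_normE; apply/seteqP; split=> y /=; rewrite /dist distrC. Qed.

#[non_forgetful_inheritance]
HB.instance Definition _ :=
  PseudoMetric_isMetric.Build R E dist_ge0 dist_positivity ballEdist.

End normed_metric.

Section coarse_geometry.
Context {R : realType} {M N : metricType R}.
Implicit Types (D : set M) (f : M -> N) (t : R).
Local Open Scope ereal_scope.

(* Modulus of the restriction of f to D. The supremum is taken in [0, +oo],
   whence the value 0, instead of -oo, for an empty set of distances. *)
Definition omega D f t : \bar R :=
  maxe 0 (ereal_sup [set d | exists x y,
    [/\ D x, D y, (mdist x y <= t)%R & d = (mdist (f x) (f y))%:E]]).

Definition rho f t : \bar R :=
  ereal_inf [set d | exists x y,
    (t <= mdist x y)%R /\ d = (mdist (f x) (f y))%:E].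

Definition coarse f := forall t, (0 <= t)%R -> omega setT f t < +oo.

Definition expanding f := rho f t @[t --> +oo%R] --> +oo.

Definition coarse_embedding f := coarse f /\ expanding f.

End coarse_geometry.

Definition convex_hull {R : realType} {E : lmodType R} (S : set E) : set E :=
  smallest (fun C : set (convex_lmodType E) => convex_set C) S.

(* Main.v *)
Require Import Defs.
From HB Require Import structures.
From mathcomp Require Import all_boot all_order all_algebra.
From mathcomp Require Import finmap all_classical all_reals interval_inference.
From mathcomp Require Import ereal topology normedtype convex.
From mathcomp Require Import unstable wochoice lra.

Set Implicit Arguments.
Unset Strict Implicit.
Unset Printing Implicit Defensive.

Import Order.TTheory GRing.Theory Num.Theory.
Import numFieldNormedType.Exports.

Local Open Scope classical_set_scope.
Local Open Scope ring_scope.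

(** Fix s > 0. The map Phi is phi on A; off A it is a locally finite average
of values of phi in the style of Dugundji: balls B(c, r c) with c outside A
cover the complement of A, each of them carries a sampling point q c, and
Phi x is the average of the phi (q c) with weights v c x supported in these
balls. The sampling points can be chosen (sampling_point) such that

- every q c that counts at x is within s of x, hence Phi x is a convex
  combination of values of phi taken within s of x;
- when x tends to a point a of A, the q c that count at x lie in A and tend
  to a, hence Phi x tends to phi a by continuity of phi on A.

The first property holds on A too, and since closed balls of E are convex it
gives |phi x - Phi x| <= omega_phi(s) for all x. For s small this is at most
inf_s omega_phi(s) + delta, which implies the announced bound because the
middle term of that bound is nonnegative; when the infimum is infinite the
bound is trivial and any s will do. If phi is coarse then omega_phi(s) is
finite, so Phi is at bounded distance from phi, and being coarse or expanding
is invariant under bounded perturbations (coarse_close, expanding_close).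

The space M may be nonseparable, so the weights require a form of
paracompactness. It is obtained directly (locally_finite_shrinking) for the
1-Lipschitz bumps f_c = max(0, r c - d(c, .)), after well-ordering their
indices. Let u_c be the amount by which f_c exceeds all earlier bumps. At a
given point the intervals between sup_(c' < c) f_c' and f_c, where nonempty,
are disjoint and of length u_c, so only finitely many u_c exceed a given
positive threshold. Keeping only the part of u_c above half of the supremum of
all the u's gives weights which are locally finite, because all these
functions are uniformly Lipschitz. *)

(** * Suprema of Lipschitz functions *)

Section lipschitz_functions.
Context {R : realType} {M : metricType R}.
Implicit Types (g h : M -> R) (k l : R).

(** The one-sided inequality bounds the absolute value of the difference, by
symmetry of the distance, and passes to suprema. *)
Definition lipschitz_le k g := forall x y, g x <= g y + k * mdist x y.

Lemma lipschitz_le_continuous k g : lipschitz_le k g -> continuous g.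
Proof.
move=> gk x; apply/cvgrPdist_le => e e0; apply/nbhs_ballP.
have k0 : 0 < `|k| + 1 by rewrite ltr_wpDl.
exists (e / (`|k| + 1)); first by rewrite /= divr_gt0.
move=> y; rewrite ballEmdist/= ltr_pdivlMr// => xy.
have kd : k * mdist x y <= (`|k| + 1) * mdist x y.
  by rewrite ler_wpM2r ?mdist_ge0// ler_wpDr// ler_norm.
have := gk x y; have := gk y x; rewrite (metric_sym y x) ler_norml => ? ?.
by apply/andP; split; lra.
Qed.

Lemma lipschitz_le_max0 k g : 0 <= k -> lipschitz_le k g ->
  lipschitz_le k (fun x => Num.max 0 (g x)).
Proof.
move=> k0 gk x y; have kd : 0 <= k * mdist x y by rewrite mulr_ge0 ?mdist_ge0.
rewrite ge_max addr_ge0//=; last by rewrite le_max lexx.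
by rewrite (le_trans (gk x y))// lerD2r le_max lexx orbT.
Qed.

Lemma lipschitz_leB k l g h :
  lipschitz_le k g -> lipschitz_le l h ->
  lipschitz_le (k + l) (fun x => g x - h x).
Proof.
move=> gk hl x y; have := gk x y; have := hl y x; rewrite metric_sym mulrDl.
lra.
Qed.

Lemma lipschitz_le_half k g :
  lipschitz_le k g -> lipschitz_le (k / 2) (fun x => g x / 2).
Proof. by move=> gk x y; have := gk x y; lra. Qed.

(** [D] may be empty: the supremum is then the constant [0]. *)
Lemma lipschitz_le_sup (I : Type) (D : set I) (f : I -> M -> R) k b : 0 <= k ->
  (forall i x, f i x <= b) -> (forall i, lipschitz_le k (f i)) ->
  lipschitz_le k (fun x => sup [set f i x | i in D]).
Proof.
move=> k0 fb fk x y; have [->|/set0P D0] := eqVneq D set0.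
  by rewrite !image_set0 sup0 add0r mulr_ge0 ?mdist_ge0.
apply: ge_sup; first exact: image_nonempty.
move=> _ [i Di <-]; rewrite (le_trans (fk i x y))// lerD2r.
by apply: ub_le_sup; [exists b => _ [j _ <-]|exists i].
Qed.

End lipschitz_functions.

(** * Locally finite shrinkings *)

Section shrinking.
Context {R : realType} {M : metricType R} {I : choiceType}.
Variables (f : I -> M -> R) (b : R).
Hypotheses (f_ge0 : forall i x, 0 <= f i x) (f_le : forall i x, f i x <= b).
Hypothesis f_lip : forall i, lipschitz_le 1 (f i).

Let le : rel I := sval (well_ordering_principle I).

Let le_wo : well_order le.
Proof. exact: svalP. Qed.

Let lt : rel I := fun j i => le j i && (j != i).

Let lt_total i j : i != j -> lt i j \/ lt j i.
Proof.
move=> ij; rewrite /lt (eq_sym j) ij !andbT; apply/orP.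
by have /wo_chainW := @withinW _ predT _ le_wo; exact.
Qed.

Let before i x := sup [set f j x | j in [set j | lt j i]].
Let excess i x := Num.max 0 (f i x - before i x).
Let top x := sup [set excess i x | i in [set: I]].
Let bump i x := Num.max 0 (excess i x - top x / 2).

Let f_le_before i j x : lt i j -> f i x <= before j x.
Proof. by move=> ij; apply: ub_le_sup; [exists b => _ [k _ <-]|exists i]. Qed.

Let before_ge0 i x : 0 <= before i x.
Proof.
rewrite /before; set D := [set j | _].
have [->|/set0P[j Dj]] := eqVneq D set0; first by rewrite image_set0 sup0.
by rewrite (le_trans (f_ge0 j x))// f_le_before.
Qed.

Let excess_le i x : excess i x <= f i x.
Proof. by rewrite ge_max f_ge0 gerBl before_ge0. Qed.

Let excess_leb i x : excess i x <= b.
Proof. exact: le_trans (excess_le i x) (f_le i x). Qed.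

Let before_lip i : lipschitz_le 1 (before i).
Proof. exact: (@lipschitz_le_sup _ _ _ _ _ _ b). Qed.

Let excess_lip i : lipschitz_le 2 (excess i).
Proof. by apply: lipschitz_le_max0 => //; exact: lipschitz_leB. Qed.

Let top_lip : lipschitz_le 2 top.
Proof. exact: (@lipschitz_le_sup _ _ _ _ _ _ b). Qed.

Let excess_le_top i x : excess i x <= top x.
Proof. by apply: ub_le_sup; [exists b => _ [k _ <-]|exists i]. Qed.

(** If [j] comes after [i] and both excesses are larger than [c], then [f j x]
is larger than [f i x + c]; hence the integer part of [f i x / c], which is
at most that of [b / c], determines [i]. *)
Let finite_excess c x : 0 < c -> finite_set [set i | c < excess i x].
Proof.
move=> c0; set D := [set i | _].
have D_incr i j : D i -> D j -> lt i j ->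
    (Num.trunc (f i x / c) < Num.trunc (f j x / c))%N.
  move=> Di Dj /f_le_before-/(_ x) fij; rewrite truncn_gt_nat -natr1.
  have -> : f j x / c = (f j x - c) / c + 1.
    by rewrite mulrBl divff ?gt_eqF ?subrK.
  rewrite lerD2r (@le_trans _ _ (f i x / c)) ?truncn_le ?divr_ge0 ?(ltW c0)//.
  rewrite ler_pM2r ?invr_gt0// (le_trans fij)// lerBrDl -lerBrDr ltW//.
  by move: Dj; rewrite /D/= /excess lt_max ltNge (ltW c0).
have D_inj : {in D &, injective (fun i => Num.trunc (f i x / c))}.
  move=> i j; rewrite !inE => Di Dj ij; apply/eqP/negP => /negP/lt_total.
  by move=> [/(D_incr _ _ Di Dj)|/(D_incr _ _ Dj Di)]; rewrite ij ltnn.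
rewrite -(eq_finite_set (inj_card_eq D_inj)).
apply: (@sub_finite_set _ _ `I_(Num.trunc (b / c)).+1) => //.
move=> _ [i _ <-]/=; rewrite ltnS le_truncn// ler_pM2r ?invr_gt0//.
Qed.

(** The first [i] with [0 < f i x] has excess [f i x]. *)
Let top_gt0 x : (exists i, 0 < f i x) -> 0 < top x.
Proof.
move=> [i0 fi0].
have [|i [[fi imin] _]] := le_wo (A := fun i => 0 < f i x); first by exists i0.
apply: lt_le_trans (excess_le_top i x).
rewrite lt_max ltxx/= subr_gt0 (le_lt_trans _ fi)//.
rewrite /before; set D := [set j | _].
have [->|/set0P D0] := eqVneq D set0; first by rewrite image_set0 sup0.
apply: ge_sup; first exact: image_nonempty.
move=> _ [j /andP[ji jNi] <-]; rewrite leNgt; apply/negP => fj.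
have ij : le i j by exact: imin.
move/negP: jNi; apply; apply/eqP.
by apply: (@wo_chain_antisymmetric _ le predT (@withinW _ predT _ le_wo)) => //;
  rewrite ji.
Qed.

(** This plays the role of a partition of unity subordinate to the cover by the
sets where some [f i] is positive, before normalization. Subtracting half of
[top], instead of a constant, keeps a positive weight at every covered
point. *)
Lemma locally_finite_shrinking : exists v : I -> M -> R,
  [/\ forall i x, 0 <= v i x,
      forall i x, 0 < v i x -> 0 < f i x,
      forall i, continuous (v i) &
      forall x, (exists i, 0 < f i x) -> (exists i, 0 < v i x) /\
        exists2 D : set I, finite_set D &
          \forall y \near x, forall i, 0 < v i y -> D i].
Proof.
exists bump; split.
- by move=> i x; rewrite le_max lexx.
- move=> i x; rewrite lt_max ltxx/= subr_gt0 => tx.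
  apply: lt_le_trans (excess_le i x); rewrite (le_lt_trans _ tx)// divr_ge0//.
  by rewrite (le_trans _ (excess_le_top i x))// le_max lexx.
- move=> i; apply: (@lipschitz_le_continuous _ _ (2 + 2 / 2)).
  by apply: lipschitz_le_max0; [lra|exact: lipschitz_leB (lipschitz_le_half _)].
- move=> x fx; have [i0 _] := fx; have t0 := top_gt0 fx; split.
    have : top x / 2 < top x by lra.
    move=> /sup_gt[|_ [i _ <-] tx].
      by exists (excess i0 x); exists i0.
    by exists i; rewrite lt_max subr_gt0 tx orbT.
  (* Within top x / 12 of x the functions top / 2 and excess i vary by at most
     top x / 12 and top x / 6: together by at most top x / 4. *)
  exists [set i | top x / 4 < excess i x].
    exact: finite_excess (divr_gt0 _ _).
  apply/nbhs_ballP; exists (top x / 12); first by rewrite /= divr_gt0.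
  move=> y; rewrite ballEmdist/= => xy i.
  rewrite lt_max ltxx/= subr_gt0 => vy.
  have := excess_lip i y x; have := top_lip x y.
  by rewrite (metric_sym y x) /=; lra.
Qed.

End shrinking.

(** * Weighted means and convex sets *)

Section convex_combinations.
Local Open Scope convex_scope.
Context {R : realType} {E : lmodType R}.
Implicit Types (C : set (convex_lmodType E)).

Lemma convex_set_mean C (I : eqType) (r : seq I) (w : I -> R) (p : I -> E) :
  convex_set C -> (forall i, 0 <= w i) -> (forall i, 0 < w i -> C (p i)) ->
  0 < \sum_(i <- r) w i ->
  C ((\sum_(i <- r) w i)^-1 *: \sum_(i <- r) w i *: p i).
Proof.
move=> Cconv w0 wC; elim: r => [|a r IHr]; first by rewrite big_nil ltxx.
rewrite !big_cons; set s := \sum_(i <- r) w i in IHr *.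
have [wa0|wa0] := eqVneq (w a) 0; first by rewrite wa0 scale0r !add0r.
have Ca : C (p a) by apply: wC; rewrite lt_neqAle eq_sym wa0 w0.
have [s0|s0] := eqVneq s 0.
  have -> : \sum_(i <- r) w i *: p i = 0.
    apply: big1_seq => i /andP[_ ir].
    have : w i <= s.
      by rewrite /s (big_rem i ir)/= lerDl sumr_ge0.
    by rewrite s0 => wi0; rewrite (@le_anti _ _ (w i) 0) ?scale0r// wi0 w0.
  by rewrite s0 !addr0 scalerA mulVf// scale1r.
have s_gt0 : 0 < s by rewrite lt_neqAle eq_sym s0 sumr_ge0.
move=> t_gt0; have t_neq0 : w a + s != 0 by rewrite gt_eqF.
have u0 : 0 <= w a / (w a + s) by rewrite divr_ge0 ?(ltW t_gt0).
have u1 : w a / (w a + s) <= 1 by rewrite ler_pdivrMr// mul1r lerDl ltW.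
have := Cconv (p a) (s^-1 *: \sum_(i <- r) w i *: p i) (Itv01 u0 u1).
rewrite !inE => /(_ Ca (IHr s_gt0)); congr C.
rewrite [LHS](_ : _ = (w a / (w a + s)) *: p a + (1 - w a / (w a + s)) *:
   (s^-1 *: \sum_(i <- r) w i *: p i))//.
rewrite scalerDr !scalerA; congr (_ *: _ + _ *: _); first exact: mulrC.
by rewrite -[in 1 - _](divff t_neq0) -mulrBl addrC addKr mulrAC divff ?mul1r.
Qed.

(** Both sums run over the support of [w], which is meant to be finite. *)
Definition weighted_mean (I : choiceType) (w : I -> R) (p : I -> E) : E :=
  (\sum_(i \in [set: I]) w i)^-1 *: \sum_(i \in [set: I]) w i *: p i.

Lemma weighted_meanE (I : choiceType) (D : set I) (w : I -> R) (p : I -> E) :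
  finite_set D -> (forall i, 0 <= w i) -> (forall i, 0 < w i -> D i) ->
  weighted_mean w p = (\sum_(i <- fset_set D) w i)^-1 *:
    \sum_(i <- fset_set D) w i *: p i.
Proof.
move=> finD w0 wD.
have wN i : ~ D i -> w i = 0.
  move=> Di; apply/eqP; rewrite eq_le w0 andbT leNgt.
  by apply/negP => /wD.
rewrite -!fsbig_finite// /weighted_mean.
by rewrite -!(fsbig_widen D setT)// => i [_ /wN wi] /=; rewrite wi ?scale0r.
Qed.

Lemma sum_fset_gt0 (I : choiceType) (D : set I) (w : I -> R) :
  finite_set D -> (forall i, 0 <= w i) -> (forall i, 0 < w i -> D i) ->
  (exists i, 0 < w i) -> 0 < \sum_(i <- fset_set D) w i.
Proof.
move=> finD w0 wD [i wi]; rewrite (big_rem i)/=; last first.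
  by rewrite in_fset_set// inE; exact: wD.
by rewrite ltr_pwDl// sumr_ge0.
Qed.

Lemma convex_set_weighted_mean C (I : choiceType) (D : set I) (w : I -> R)
    (p : I -> E) : convex_set C ->
  finite_set D -> (forall i, 0 <= w i) -> (forall i, 0 < w i -> D i) ->
  (exists i, 0 < w i) -> (forall i, 0 < w i -> C (p i)) ->
  C (weighted_mean w p).
Proof.
move=> Cconv finD w0 wD wgt0 wC; rewrite (weighted_meanE p finD w0 wD).
by apply: convex_set_mean => //; exact: sum_fset_gt0.
Qed.

End convex_combinations.

Section closed_balls.
Local Open Scope convex_scope.

Lemma convex_closed_ball (R : realType) (E : normedModType R) (a : E) (r : R) :
  convex_set ([set z | `|a - z| <= r] : set (convex_lmodType E)).
Proof.
move=> x y t; rewrite !inE/= => ax ay.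
rewrite [X in `|X|](_ : _ = (a - x : convex_lmodType E) <| t |>
                            (a - y : convex_lmodType E)); last first.
  by rewrite opprD -[in LHS](convmm t (a : convex_lmodType E)) addrACA
    -scalerBr -scalerBr.
rewrite (le_trans (ler_normD _ _))// !normrZ !ger0_norm ?onem_ge0//.
rewrite -[leRHS]mul1r -(add_onemK t%:num) [leRHS]mulrDl.
by apply: lerD; apply: ler_wpM2l => //=; rewrite onem_ge0.
Qed.

End closed_balls.

(** Near [x] both sums run over the same finite set [D] of indices. *)
Lemma weighted_mean_continuous (R : realType) (M : topologicalType)
    (E : normedModType R) (I : choiceType) (D : set I) (v : I -> M -> R)
    (p : I -> E) (x : M) :
  finite_set D -> (forall i x, 0 <= v i x) -> (forall i, continuous (v i)) ->
  (exists i, 0 < v i x) -> (\forall y \near x, forall i, 0 < v i y -> D i) ->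
  {for x, continuous (fun y => weighted_mean (v^~ y) p)}.
Proof.
move=> finD v0 v_cont vx vD.
rewrite /continuous_at /prop_for /=.
have vxD : forall i, 0 < v i x -> D i by exact: nbhs_singleton vD.
rewrite (weighted_meanE p finD _ vxD)//.
suff H : (\sum_(i <- fset_set D) v i y)^-1 *:
    \sum_(i <- fset_set D) v i y *: p i @[y --> x] -->
  (\sum_(i <- fset_set D) v i x)^-1 *: \sum_(i <- fset_set D) v i x *: p i.
  apply: cvg_trans H; apply: near_eq_cvg; near=> y.
  rewrite (weighted_meanE p finD)//.
  by near: y; exact: vD.
apply: cvgZ; last first.
  apply: cvg_big => [|i _]; first exact: add_continuous.
  by apply: cvgZ; [exact: v_cont|exact: cvg_cst].
apply: cvgV; first by rewrite gt_eqF// sum_fset_gt0.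
by apply: cvg_big => [|i _]; [exact: add_continuous|exact: v_cont].
Unshelve. all: by end_near. Qed.

(** * Invariance under bounded perturbations *)

Section bounded_perturbation.
Context {R : realType} {M N : metricType R}.
Variables (f g : M -> N) (K : R).
Hypothesis fg : forall x, mdist (f x) (g x) <= K.

Let mdist_le_close x y : mdist (g x) (g y) <= mdist (f x) (f y) + K * 2.
Proof.
have := metric_triangle (g x) (f x) (g y).
have := metric_triangle (f x) (f y) (g y).
have := fg x; have := fg y; rewrite (metric_sym (g x) (f x)); lra.
Qed.

Let mdist_ge_close x y : mdist (f x) (f y) <= mdist (g x) (g y) + K * 2.
Proof.
have := metric_triangle (f x) (g x) (f y).
have := metric_triangle (g x) (g y) (f y).
have := fg x; have := fg y; rewrite (metric_sym (g y) (f y)); lra.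
Qed.

Lemma coarse_close : coarse f -> coarse g.
Proof.
move=> fc t /[dup] t0 /fc; set w := omega _ _ _ => w_fin.
apply: (@le_lt_trans _ _ (maxe 0 (w + (K * 2)%:E))%E); last first.
  by rewrite gt_max ltry/= lte_add_pinfty// ltry.
rewrite /omega ge_max le_max lexx/=.
apply: ge_ereal_sup => _ [x [y [_ _ xy ->]]].
rewrite le_max; apply/orP; right.
apply: (@le_trans _ _ ((mdist (f x) (f y))%:E + (K * 2)%:E)%E).
  by rewrite -EFinD lee_fin.
rewrite leeD2r// /w le_max; apply/orP; right.
by apply: ereal_sup_ubound; exists x, y.
Qed.

Lemma expanding_close : expanding f -> expanding g.
Proof.
move=> /cvgeyPge fe; apply/cvgeyPge => B.
near=> t; apply: le_ereal_inf_tmp => _ [x [y [txy ->]]].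
have : ((B + K * 2)%:E <= rho f t)%E by near: t; exact: fe.
have rfxy : (rho f t <= (mdist (f x) (f y))%:E)%E.
  by apply: ereal_inf_lbound; exists x, y.
move=> /le_trans/(_ rfxy); rewrite !lee_fin => ?.
by have := mdist_ge_close x y; lra.
Unshelve. all: by end_near. Qed.

End bounded_perturbation.

(** * The extension *)

(** Here [ry] is the pair of a radius and a sampling point. Let d be the
distance from [c] to [A]. If d < s / 2, the radius is d / 2 and the sampling
point is an almost nearest point of [A], at distance less than 2 d from [c]:
every point of [A] is at least d / 2 away from the ball, whence the factor 6,
as 2 d + d / 2 is 5 times that. If d >= s / 2 or [A] is empty, the radius is
s / 4, the sampling point is [c], and no point of the ball is within s / 4 of
[A].
The radius 0 at points of [A], which gives an empty ball, allows the centers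
to range over the whole space. *)
Lemma sampling_point (R : realType) (M : metricType R) (A : set M) (s : R)
    (c : M) : closed A -> 0 < s ->
  exists ry : R * M, [/\ 0 <= ry.1, ry.1 <= s, ~ A c -> 0 < ry.1 &
    forall x, mdist c x < ry.1 -> mdist x ry.2 <= s /\
      forall a, A a -> mdist x a < s / 4 ->
        A ry.2 /\ mdist ry.2 a <= 6 * mdist x a].
Proof.
move=> Acl s0; have [Ac|Ac] := pselect (A c).
  by exists (0, c); split=> //=; [exact: ltW|move=> x; rewrite ltNge mdist_ge0].
have [[a0 Aa0 ca0]|far] := pselect (exists2 a, A a & mdist c a < s / 2);
    last first.
  exists (s / 4, c); split=> /=; [lra|lra|lra|move=> x cx; split].
    by rewrite metric_sym; lra.
  move=> a Aa xa; exfalso; apply: far; exists a => //.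
  by have := metric_triangle c x a; lra.
pose S := [set mdist c a | a in A]; pose d := inf S.
have S_inf : has_inf S.
  by split; [exists (mdist c a0), a0|exists 0 => _ [a _ <-]; exact: mdist_ge0].
have d_le a : A a -> d <= mdist c a.
  by move=> Aa; apply: ge_inf; [exact: S_inf.2|exists a].
have d0 : 0 < d.
  have : nbhs c (~` A) by apply: open_nbhs_nbhs; split; [exact: closed_openC|].
  move=> /nbhs_ballP[e /= e0]; rewrite ballEmdist => eA.
  apply: lt_le_trans e0 _; apply: lb_le_inf; first exact: S_inf.1.
  by move=> _ [a Aa <-]; rewrite leNgt; apply/negP => /eA; exact.
have [_ [a1 Aa1 <-] ca1] := inf_adherent d0 S_inf.
have [a [Aa cas cad]] : exists a,
    [/\ A a, mdist c a < s / 2 & mdist c a < d * 2].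
  have [|] := leP (s / 2) (mdist c a1) => ca1s; last first.
    by exists a1; split=> //; rewrite -/d in ca1; lra.
  by exists a0; split=> //; rewrite -/d in ca1; lra.
have := d_le _ Aa => dca.
exists (d / 2, a); split=> /=; [lra|lra|lra|move=> x cx; split].
  by have := metric_triangle x c a; rewrite (metric_sym x c); lra.
move=> a' Aa' _; split=> //.
have := d_le _ Aa'; have := metric_triangle c x a'.
have := metric_triangle a c a'.
rewrite (metric_sym a c); lra.
Qed.

(** The values of [Phi] are located by quantifying over the convex sets [C]
because two kinds of them are needed: closed balls of [E], for the estimate,
and the convex sets containing the whole range of [phi]. *)
Lemma local_convex_extension (R : realType) (M : metricType R) (A : set M)
    (E : normedModType R) (phi : M -> E) (s : R) :
  closed A -> {within A, continuous phi} -> 0 < s ->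
  exists Phi : M -> E,
    [/\ continuous Phi, forall x, A x -> Phi x = phi x &
        forall x (C : set (convex_lmodType E)), convex_set C ->
          (forall y, mdist x y <= s -> C (phi y)) -> C (Phi x)].
Proof.
move=> Acl phiA s0.
have [ry ryP] := choice (fun c => sampling_point c Acl s0).
pose r c := (ry c).1; pose q c := (ry c).2.
pose f c x := Num.max 0 (r c - mdist c x).
have f_gt0 c x : 0 < f c x -> mdist c x < r c.
  by rewrite lt_max ltxx/= subr_gt0.
have f_le c x : f c x <= s.
  have [_ rs _ _] := ryP c; rewrite ge_max (ltW s0)/=.
  by rewrite lerBlDr (le_trans rs)// lerDl mdist_ge0.
have f_lip c : lipschitz_le 1 (f c).
  apply: lipschitz_le_max0 => // x y; rewrite mul1r.
  by have := metric_triangle c x y; lra.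
have f_ge0 c x : 0 <= f c x by rewrite le_max lexx.
have [v [v0 vf v_cont v_fin]] := locally_finite_shrinking f_ge0 f_le f_lip.
have f_cover x : ~ A x -> exists c, 0 < f c x.
  by move=> Ax; exists x; have [_ _ /(_ Ax)] := ryP x;
    rewrite lt_max mdistxx subr0 => ->; rewrite orbT.
pose mean x := weighted_mean (v^~ x) (phi \o q).
have mean_convex x (C : set (convex_lmodType E)) : ~ A x -> convex_set C ->
    (forall c, mdist c x < r c -> C (phi (q c))) -> C (mean x).
  move=> /f_cover/v_fin[vx [D finD /nbhs_singleton vD]] Cc Cq.
  apply: (convex_set_weighted_mean Cc finD) => // c /vf/f_gt0; exact: Cq.
pose Phi x := if `[< A x >] then phi x else mean x.
have PhiA x : A x -> Phi x = phi x by move=> Ax; rewrite /Phi; case: asboolP.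
have PhiN x : ~ A x -> Phi x = mean x by move=> Ax; rewrite /Phi; case: asboolP.
exists Phi; split => //; last first.
  move=> x C Cc CP; have [Ax|Ax] := pselect (A x).
    by rewrite PhiA//; apply: CP; rewrite mdistxx ltW.
  rewrite PhiN//; apply: mean_convex => // c cx.
  by apply: CP; have [_ _ _ /(_ _ cx)[]] := ryP c.
move=> a; have [Aa|Aa] := pselect (A a); last first.
  have [va [D finD vD]] := v_fin _ (f_cover _ Aa).
  have := weighted_mean_continuous (p := phi \o q) finD v0 v_cont va vD.
  rewrite /prop_for /continuous_at (PhiN _ Aa) => mean_cont.
  apply: cvg_trans mean_cont; apply: near_eq_cvg.
  have : nbhs a (~` A) by apply: open_nbhs_nbhs; split; [exact: closed_openC|].
  by apply: filterS => x Ax; rewrite PhiN.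
move/subspace_continuousP : phiA => /(_ a Aa)/cvgrPdist_le phi_a.
apply/cvgrPdist_le => e e0; rewrite PhiA//.
have := phi_a e e0; rewrite /prop_near1 => /nbhs_ballP[h /= h0].
rewrite ballEmdist => near_a.
(* Below s / 4 the sampling points are in A, and below h / 6 they are within h
   of a, where phi is e-close to phi a. *)
apply/nbhs_ballP; exists (Num.min (s / 4) (h / 6)).
  by rewrite /= lt_min !divr_gt0.
move=> x; rewrite ballEmdist/= lt_min => /andP[axs axh].
have [Ax|Ax] := pselect (A x).
  by rewrite PhiA//; apply: near_a => //=; lra.
rewrite PhiN//.
apply: (mean_convex x [set z | `|phi a - z| <= e]) => //.
  exact: convex_closed_ball.
move=> c cx; have [_ _ _ /(_ _ cx)[_]] := ryP c.
rewrite metric_sym in axs axh.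
move=> /(_ _ Aa axs)[Aq qa]; apply: near_a => //=.
by rewrite metric_sym; rewrite /q; lra.
Qed.

Lemma omega_ge0 (R : realType) (M N : metricType R) (D : set M) (f : M -> N) t :
  (0 <= omega D f t)%E.
Proof. by rewrite le_max lexx. Qed.

Lemma exists_omega_le (R : realType) (M N : metricType R) (D D' : set M)
    (f : M -> N) (delta : R) : 0 < delta ->
  exists2 s : R, 0 < s & (omega D f s <=
    ereal_inf [set omega D f s | s in [set s : R | (0 < s)%R]]
    + ereal_inf [set omega D' f s | s in [set s : R | (0 < s)%R]] + delta%:E)%E.
Proof.
move=> delta0.
have inf_ge0 D0 :
    (0 <= ereal_inf [set omega D0 f s | s in [set s : R | (0 < s)%R]])%E.
  by apply: le_ereal_inf_tmp => _ [t _ <-]; exact: omega_ge0.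
have := inf_ge0 D; have := inf_ge0 D'.
set i' := ereal_inf _; set i := ereal_inf [set omega D f _ | _ in _] => i'0 i0.
have [ioo|i_fin] := eqVneq i +oo%E.
  exists 1 => //; rewrite ioo !addye ?leey// gt_eqF//.
  by rewrite (lt_le_trans _ i'0).
have fin_i : i \is a fin_num by rewrite ge0_fin_numE// lt_neqAle i_fin leey.
have [_ [s /= s0 <-] si] := lb_ereal_inf_adherent delta0 fin_i.
by exists s => //; rewrite (le_trans (ltW si))// leeD2r// leeDl.
Qed.

Theorem theorem1p4 (R : realType) (M : metricType R) (A : set M)
    (E : normedModType R) (phi : M -> E) (delta : R) :
  closed A -> {within A, continuous phi} -> 0 < delta ->
  exists Phi : M -> E,
    [/\ continuous Phi,
        forall x, convex_hull (range phi) (Phi x),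
        forall x, A x -> Phi x = phi x,
        (ereal_sup [set `|phi x - Phi x|%:E | x in [set: M]]
         <= ereal_inf [set omega setT phi s | s in [set s : R | (0 < s)%R]]
            + ereal_inf [set omega A phi s | s in [set s : R | (0 < s)%R]]
            + delta%:E)%E
      & (coarse phi -> coarse Phi) /\
        (coarse_embedding phi -> coarse_embedding Phi)].
Proof.
move=> Acl phiA delta0.
have [s s0 ws] := exists_omega_le setT A phi delta0.
have [Phi [Phi_cont PhiA Phi_conv]] := local_convex_extension Acl phiA s0.
have Phi_close x : (`|phi x - Phi x|%:E <= omega setT phi s)%E.
  case w_eq : (omega setT phi s) => [w||]; last 2 first.
  - exact: leey.
  - by have := omega_ge0 setT phi s; rewrite w_eq.
  rewrite lee_fin; apply: (Phi_conv x [set z | `|phi x - z| <= w]).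
    exact: convex_closed_ball.
  move=> y xy; rewrite /= -lee_fin -w_eq le_max; apply/orP; right.
  by apply: ereal_sup_ubound; exists y, x; split=> //; rewrite metric_sym.
have coarse_Phi : coarse phi ->
    exists K, forall x, mdist (phi x) (Phi x) <= K.
  move=> /(_ s (ltW s0)) w_fin; exists (fine (omega setT phi s)) => x.
  rewrite -lee_fin fineK ?ge0_fin_numE ?omega_ge0//.
  by rewrite metric_sym; exact: Phi_close.
exists Phi; split => //.
- by move=> x C [Cc phiC]; apply: Phi_conv => // y _; apply: phiC; exists y.
- apply: ge_ereal_sup => _ [x _ <-]; exact: le_trans (Phi_close x) ws.
- split=> [/[dup] /coarse_Phi[K phiK]|[/[dup] /coarse_Phi[K phiK]]].
    exact: coarse_close phiK.
  move=> phic phie.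
  by split; [exact: coarse_close phic|exact: expanding_close phie].
Qed.
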